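(* Let $T=T((m_1,k_1),\dots,(m_l,k_l);p)$ and $S=T((n_1,r_1),\dots,(n_l,r_l);q)$ be two trees of diameter 4. Suppose that $\frac{m_i}{n_i}=\frac{m_j}{n_j}$ for all $i,j=1,\dots,l$. Then $\mathbb{G}(T)$ is commensurable to $\mathbb{G}(S)$.
   Context: For a finite simplicial graph $\Gamma$, $\mathbb{G}(\Gamma)$ is the right-angled Artin group with generators the vertices of $\Gamma$ and relations $[u,v]=1$ for each edge. Two groups are commensurable if they have isomorphic finite index subgroups. Encoding of trees of diameter 4: in a finite tree of diameter 4 the middle vertex of any path of length 4 is the same vertex $c$, the center; leaves adjacent to $c$ are hair vertices; other neighbours of $c$ are pivots. $T((d_1,k_1),\dots,(d_l,k_l);q)$ is the tree of diameter 4 with exactly $q\ge0$ hair vertices and, for each $i$, exactly $k_i$ pivots adjacent to exactly $d_i$ leaves, where $l,d_i,k_i$ are positive integers, $d_1<\dots<d_l$, and either $l\ge2$ or ($l=1$ and $k_1\ge2$). *)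

(* Defs.v *)
(* groups are handled concretely as words modulo
   the RAAG relations (setoid-style), since infinite groups are not in MathComp. *)
From mathcomp Require Import all_boot.
From Stdlib Require Import Relations.Relation_Operators.

Set Implicit Arguments.
Unset Strict Implicit.
Unset Printing Implicit Defensive.

(* Right-angled Artin group G(Gamma) of a simple graph Gamma = (V, e):     *)
(* elements are words in the letters v^(+1), v^(-1) (v : V), modulo the   *)
(* congruence generated by free cancellation and by the commutation of    *)
(* letters whose underlying vertices are adjacent. Product = concatenation.*)

Definition letter (V : Type) := (V * bool)%type.   (* (v, true) = v, (v,false) = v^-1 *)
Definition word (V : Type) := seq (letter V).

Definition inv_letter (V : Type) (x : letter V) : letter V := (x.1, ~~ x.2).
Definition inv_word (V : Type) (w : word V) : word V := rev (map (@inv_letter V) w).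

Inductive raag_step (V : Type) (e : V -> V -> Prop) : word V -> word V -> Prop :=
| raag_cancel (u v : word V) (x : letter V) :
    raag_step e (u ++ x :: inv_letter x :: v) (u ++ v)
| raag_comm (u v : word V) (a b : letter V) :
    e a.1 b.1 -> raag_step e (u ++ a :: b :: v) (u ++ b :: a :: v).

Definition raag_eq (V : Type) (e : V -> V -> Prop) : word V -> word V -> Prop :=
  clos_refl_sym_trans (word V) (raag_step e).

Definition raag_subgroup (V : Type) (e : V -> V -> Prop) (H : word V -> Prop) : Prop :=
  [/\ (forall x y, H x -> raag_eq e x y -> H y),
      H [::],
      (forall x y, H x -> H y -> H (x ++ y)) &
      (forall x, H x -> H (inv_word x))].

Definition raag_finite_index (V : Type) (e : V -> V -> Prop) (H : word V -> Prop) : Prop :=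
  exists (N : nat) (g : 'I_N -> word V),
    forall w : word V, exists (i : 'I_N) (h : word V), H h /\ raag_eq e w (g i ++ h).

Definition raag_sub_iso (V1 V2 : Type) (e1 : V1 -> V1 -> Prop) (e2 : V2 -> V2 -> Prop)
    (H1 : word V1 -> Prop) (H2 : word V2 -> Prop) (phi : word V1 -> word V2) : Prop :=
  [/\ (forall x, H1 x -> H2 (phi x)),
      (forall x y, H1 x -> H1 y -> (raag_eq e1 x y <-> raag_eq e2 (phi x) (phi y))),
      (forall x y, H1 x -> H1 y -> raag_eq e2 (phi (x ++ y)) (phi x ++ phi y)) &
      (forall y, H2 y -> exists x, H1 x /\ raag_eq e2 (phi x) y)].

Definition raag_commensurable (V1 V2 : Type) (e1 : V1 -> V1 -> Prop) (e2 : V2 -> V2 -> Prop)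
  : Prop :=
  exists (H1 : word V1 -> Prop) (H2 : word V2 -> Prop) (phi : word V1 -> word V2),
    [/\ raag_subgroup e1 H1, raag_finite_index e1 H1,
        raag_subgroup e2 H2, raag_finite_index e2 H2 &
        raag_sub_iso e1 e2 H1 H2 phi].

(* The tree T((d_1,k_1),...,(d_l,k_l); q) (indices i : 'I_l):             *)
(* a center, q hair vertices, for each i exactly k_i pivots, each pivot   *)
(* of type i carrying exactly d_i leaves.                                 *)

Inductive tvert (l : nat) (d k : 'I_l -> nat) (q : nat) : Type :=
| TCenter
| THair of 'I_q
| TPivot (i : 'I_l) of 'I_(k i)
| TLeaf (i : 'I_l) of 'I_(k i) & 'I_(d i).

Arguments TCenter {l d k q}.
Arguments THair {l d k q}.
Arguments TPivot {l d k q}.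
Arguments TLeaf {l d k q}.

Definition tadj (l : nat) (d k : 'I_l -> nat) (q : nat) (x y : tvert d k q) : Prop :=
  match x, y with
  | TCenter, THair _ | THair _, TCenter => True
  | TCenter, TPivot _ _ | TPivot _ _, TCenter => True
  | TPivot i j, TLeaf i' j' _ => i = i' /\ nat_of_ord j = nat_of_ord j'
  | TLeaf i' j' _, TPivot i j => i = i' /\ nat_of_ord j = nat_of_ord j'
  | _, _ => False
  end.

Definition tree_params (l : nat) (d k : 'I_l -> nat) : Prop :=
  [/\ 0 < l,
      (forall i, 0 < d i /\ 0 < k i),
      (forall i j : 'I_l, i < j -> d i < d j) &
      (2 <= l \/ (l = 1 /\ forall i, 2 <= k i))].

(* Main.v *)
Require Import Defs.
From mathcomp Require Import all_boot zify.
From Stdlib Require Import Relations.Relation_Operators RelationClasses Morphisms Setoid.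
From Stdlib Require Import ClassicalEpsilon FunctionalExtensionality.

(** Write [chi = p + K - 1], where [K] is the number of pivots. Two kinds of
finite cyclic covers of [G(T)] are again groups of trees of diameter 4.

Sending the center to a generator of [Z/N] and every other vertex to [0]
unwraps the center in the centralizer of each pivot: the leaf numbers [d_i]
are multiplied by [N], and nothing else changes. Proportional leaf numbers
thus become equal.

Sending some pivots to a generator of [Z/N] and all other vertices to [0]
replaces [chi] by [N * chi]; a pivot sent to [0] has [N] lifts and any other
pivot only one, all of them with the same number of leaves. With [N = 2] and a
single pivot sent to [0] this adds one pivot of a chosen type and doubles
[chi]; with no pivot sent to [0] it only multiplies [chi] by [N]. Hence the
groups of two trees with equal leaf numbers share a finite index subgroup: bring
the pivot numbers to their maximum, then equalize [chi]. *)

Set Implicit Arguments.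
Unset Strict Implicit.
Unset Printing Implicit Defensive.

(** * Formal inverses of words, and congruences turning words into a group *)

Section Words.
Variable V : Type.
Implicit Types (u v w : word V).

Lemma inv_letterK : involutive (@inv_letter V).
Proof. by case=> a b; rewrite /inv_letter /= negbK. Qed.

Lemma inv_wordK : involutive (@inv_word V).
Proof.
move=> w; rewrite /inv_word map_rev revK -map_comp -[RHS]map_id.
by apply: eq_map => x /=; rewrite inv_letterK.
Qed.

Lemma inv_word_cat u v : inv_word (u ++ v) = inv_word v ++ inv_word u.
Proof. by rewrite /inv_word map_cat rev_cat. Qed.

Lemma inv_word_cons x w : inv_word (x :: w) = inv_word w ++ [:: inv_letter x].
Proof. by rewrite -cat1s inv_word_cat. Qed.

End Words.

(** Words modulo such an [R] form a group. The same calculus then serves both [raag_eq] and the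
    relations pulled back along a map, to which [raag_eq_least] is applied. *)
Class word_congr (V : Type) (R : word V -> word V -> Prop) : Prop := {
  word_congr_equiv : Equivalence R;
  word_congr_cat : Proper (R ==> R ==> R) (@cat (letter V));
  word_congr_cancel : forall x, R [:: x; inv_letter x] [::] }.

#[export] Existing Instance word_congr_equiv.
#[export] Existing Instance word_congr_cat.

Section Congruence.
Variables (V : Type) (R : word V -> word V -> Prop).
Context {RC : word_congr R}.
Implicit Types (u v w : word V).

Lemma congr_mulV w : R (w ++ inv_word w) [::].
Proof.
elim: w => [|x w IH]; first by rewrite /inv_word /=; reflexivity.
rewrite inv_word_cons -cat1s -catA (catA w) IH /=.
exact: word_congr_cancel.
Qed.

Lemma congr_Vmul w : R (inv_word w ++ w) [::].
Proof. by rewrite -{2}(inv_wordK w); apply: congr_mulV. Qed.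

Lemma congr_mulKV w u : R (w ++ inv_word w ++ u) u.
Proof. by rewrite catA congr_mulV; reflexivity. Qed.

Lemma congr_mulVK w u : R (inv_word w ++ w ++ u) u.
Proof. by rewrite catA congr_Vmul; reflexivity. Qed.

Lemma congr_cancelr u v w : R (u ++ w) (v ++ w) -> R u v.
Proof.
move=> E; rewrite -(cats0 u) -(cats0 v) -(congr_mulV w) !catA E; reflexivity.
Qed.

#[export] Instance congr_inv : Proper (R ==> R) (@inv_word V).
Proof.
move=> u v E; apply: (@congr_cancelr _ _ v).
by rewrite congr_Vmul -E congr_Vmul; reflexivity.
Qed.

Definition comm u v := R (u ++ v) (v ++ u).

Lemma comm_sym u v : comm u v -> comm v u.
Proof. by rewrite /comm => E; symmetry. Qed.

Lemma comm0 u : comm u [::].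
Proof. by rewrite /comm cats0 /=; reflexivity. Qed.

Lemma comm_cat u v w : comm u v -> comm u w -> comm u (v ++ w).
Proof. by rewrite /comm => E F; rewrite catA E -catA F catA; reflexivity. Qed.

Lemma comm_invr u v : comm u v -> comm u (inv_word v).
Proof.
rewrite /comm => E; apply: (@congr_cancelr _ _ v).
by rewrite -!catA congr_Vmul cats0 E congr_mulVK; reflexivity.
Qed.

Lemma comm_nseq u n a : comm u [:: a] -> comm u (nseq n a).
Proof.
move=> E; elim: n => [|n IH]; first exact: comm0.
by rewrite /= -cat1s; apply: comm_cat.
Qed.

End Congruence.

Lemma raag_eq_step (V : Type) (e : V -> V -> Prop) u v :
  raag_step e u v -> raag_eq e u v.
Proof. exact: rst_step. Qed.

#[export] Instance raag_eq_equiv (V : Type) (e : V -> V -> Prop) :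
  Equivalence (raag_eq e).
Proof.
split=> [x|x y|x y z]; [exact: rst_refl|exact: rst_sym|exact: rst_trans].
Qed.

#[export] Instance raag_eq_congr (V : Type) (e : V -> V -> Prop) :
  word_congr (raag_eq e).
Proof.
have catl w u v : raag_eq e u v -> raag_eq e (w ++ u) (w ++ v).
  elim=> {u v} [u v [] *|u|u v _ IH|u v x _ IH1 _ IH2].
  - by rewrite !catA; apply/raag_eq_step/raag_cancel.
  - by rewrite !catA; apply/raag_eq_step/raag_comm.
  - exact: rst_refl.
  - exact: rst_sym.
  - exact: rst_trans IH2.
have catr w u v : raag_eq e u v -> raag_eq e (u ++ w) (v ++ w).
  elim=> {u v} [u v [] *|u|u v _ IH|u v x _ IH1 _ IH2].
  - by rewrite -!catA; apply/raag_eq_step/raag_cancel.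
  - by rewrite -!catA; apply/raag_eq_step/raag_comm.
  - exact: rst_refl.
  - exact: rst_sym.
  - exact: rst_trans IH2.
split; first exact: raag_eq_equiv.
- move=> u u' Eu v v' Ev; exact: rst_trans (catr _ _ _ Eu) (catl _ _ _ Ev).
- by move=> x; apply/raag_eq_step/(raag_cancel e [::] [::]).
Qed.

(** The universal property of the group: with [R] pulled back along a map, it shows that the map
    respects the defining relations. Positive letters suffice because commuting passes to inverses
    ([comm_invr]). *)
Lemma raag_eq_least (V : Type) (e : V -> V -> Prop) (R : word V -> word V -> Prop) :
  word_congr R ->
  (forall a b, e a b -> comm R [:: (a, true)] [:: (b, true)]) ->
  forall u v, raag_eq e u v -> R u v.
Proof.
move=> RC He u v; elim=> {u v} [u v []|u|u v _ IH|u v x _ IH1 _ IH2].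
- move=> {}u {}v x; rewrite -[x :: _]/([:: x; inv_letter x] ++ v).
  by rewrite word_congr_cancel; reflexivity.
- move=> {}u {}v a b eab.
  have com : comm R [:: a] [:: b].
    case: a b eab => [a s] [b t] /= /He C.
    have invE c : [:: (c, false)] = inv_word [:: (c, true)] :> word V by [].
    have C' : comm R [:: (a, true)] [:: (b, t)].
      by case: t => //; rewrite invE; apply: comm_invr.
    case: s => //; apply: comm_sym; rewrite invE.
    by apply: comm_invr; apply: comm_sym.
  rewrite -[a :: _]/([:: a] ++ [:: b] ++ v) -[b :: a :: _]/([:: b] ++ [:: a] ++ v).
  by rewrite (catA [:: a]) com -catA; reflexivity.
- by reflexivity.
- by symmetry.
- by rewrite IH1.
Qed.

(** * Homomorphisms given on generators, and finite index embeddings *)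

Section Subst.
Variables (V V' : Type) (phi : V' -> word V).

Definition subst_letter (x : letter V') : word V :=
  if x.2 then phi x.1 else inv_word (phi x.1).
Definition subst (w : word V') : word V := flatten (map subst_letter w).

Lemma subst_cat u v : subst (u ++ v) = subst u ++ subst v.
Proof. by rewrite /subst map_cat flatten_cat. Qed.

Lemma subst1 a : subst [:: (a, true)] = phi a.
Proof. by rewrite /subst /= cats0. Qed.

Lemma subst_inv w : subst (inv_word w) = inv_word (subst w).
Proof.
elim: w => [|[a s] w IH] //.
rewrite inv_word_cons -[(a, s) :: w]cat1s !subst_cat inv_word_cat IH.
by congr (_ ++ _); rewrite /subst /= !cats0; case: s; rewrite /subst_letter /= ?inv_wordK.
Qed.

Variables (e : V -> V -> Prop) (e' : V' -> V' -> Prop).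

Lemma subst_raag_eq :
  (forall a b, e' a b -> comm (raag_eq e) (phi a) (phi b)) ->
  forall u v, raag_eq e' u v -> raag_eq e (subst u) (subst v).
Proof.
move=> He; apply: raag_eq_least => [|a b /He]; last first.
  by rewrite /comm !subst_cat !subst1.
split=> [|u u' Eu v v' Ev|x].
- split=> [u|u v|u v w]; [reflexivity|by symmetry|by move=> -> ->; reflexivity].
- by rewrite !subst_cat Eu Ev; reflexivity.
- rewrite -[[:: x; _]]/([:: x] ++ inv_word [:: x]) subst_cat subst_inv.
  exact: congr_mulV.
Qed.

End Subst.

Lemma subst_subst (V V' V'' : Type) (phi : V' -> word V) (psi : V'' -> word V') w :
  subst phi (subst psi w) = subst (fun a => subst phi (psi a)) w.
Proof.
elim: w => [|[a s] w IH] //.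
rewrite -[(a, s) :: w]cat1s !subst_cat IH; congr (_ ++ _).
by rewrite /subst /= !cats0; case: s; rewrite /subst_letter //= -subst_inv.
Qed.

(** The homomorphism [subst phi] is injective on group elements, and finitely many left cosets of
    its image, with representatives [g x], cover the target. *)
Definition fi_embeds (V' V : Type) (e' : V' -> V' -> Prop) (e : V -> V -> Prop) :=
  exists phi : V' -> word V,
    (forall u v, raag_eq e' u v <-> raag_eq e (subst phi u) (subst phi v)) /\
    exists (X : finType) (g : X -> word V),
      forall w, exists x u, raag_eq e w (g x ++ subst phi u).

Lemma fi_embeds_trans (V1 V2 V3 : Type) (e1 : V1 -> V1 -> Prop)
    (e2 : V2 -> V2 -> Prop) (e3 : V3 -> V3 -> Prop) :
  fi_embeds e1 e2 -> fi_embeds e2 e3 -> fi_embeds e1 e3.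
Proof.
move=> [phi [phiE [X [g gP]]]] [psi [psiE [Y [h hP]]]].
exists (fun a => subst psi (phi a)); split.
  by move=> u v; rewrite -!subst_subst -psiE.
exists (Y * X)%type, (fun yx => h yx.1 ++ subst psi (g yx.2)) => w.
have [y [u wE]] := hP w; have [x [v uE]] := gP u.
exists (y, x), v => /=; rewrite -subst_subst -catA -subst_cat wE.
by move/psiE: uE => ->; reflexivity.
Qed.

(** The two images of the common group are the required subgroups; the isomorphism between them goes
    back along [phi1] and then along [phi2]. *)
Lemma fi_embeds_commensurable (V V1 V2 : Type) (e : V -> V -> Prop)
    (e1 : V1 -> V1 -> Prop) (e2 : V2 -> V2 -> Prop) :
  fi_embeds e e1 -> fi_embeds e e2 -> raag_commensurable e1 e2.
Proof.
have image_subgroup (W : Type) (f : W -> W -> Prop) (phi : V -> word W) :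
    raag_subgroup f (fun x => exists u, raag_eq f x (subst phi u)).
  split=> [x y [u xE] xy||x y [u xE] [v yE]|x [u xE]].
  - by exists u; rewrite -xy.
  - by exists [::]; reflexivity.
  - by exists (u ++ v); rewrite subst_cat xE yE; reflexivity.
  - by exists (inv_word u); rewrite subst_inv xE; reflexivity.
have image_index (W : Type) (f : W -> W -> Prop) (phi : V -> word W) :
    (exists (X : finType) (g : X -> word W),
      forall w, exists x u, raag_eq f w (g x ++ subst phi u)) ->
    raag_finite_index f (fun x => exists u, raag_eq f x (subst phi u)).
  move=> [X [g gP]]; exists #|X|, (fun i => g (enum_val i)) => w.
  have [x [u wE]] := gP w; exists (enum_rank x), (subst phi u).
  by rewrite enum_rankK; split=> //; exists u; reflexivity.
move=> [phi1 [E1 I1]] [phi2 [E2 I2]].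
(* A chosen preimage word under [phi1]. Equal elements may get different words, but these agree in
   the group of [e] because [phi1] is injective. *)
pose pre x := epsilon (inhabits [::]) (fun u => raag_eq e1 x (subst phi1 u)).
have preP x : (exists u, raag_eq e1 x (subst phi1 u)) ->
    raag_eq e1 x (subst phi1 (pre x)) by apply: epsilon_spec.
exists (fun x => exists u, raag_eq e1 x (subst phi1 u)).
exists (fun x => exists u, raag_eq e2 x (subst phi2 u)).
exists (fun x => subst phi2 (pre x)); split; auto.
split=> [x _|x y Hx Hy|x y Hx Hy|y [u yE]].
- by exists (pre x); reflexivity.
- rewrite -E2 E1 -(preP _ Hx) -(preP _ Hy); reflexivity.
- rewrite -subst_cat -E2 E1 subst_cat -(preP _ Hx) -(preP _ Hy) -preP.
    by reflexivity.
  by have [_ _ + _] := image_subgroup _ e1 phi1; apply.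
- exists (subst phi1 u).
  have Hu : exists v, raag_eq e1 (subst phi1 u) (subst phi1 v).
    by exists u; reflexivity.
  by split=> //; rewrite yE -E2 E1 -preP //; reflexivity.
Qed.

(* Reidemeister-Schreier: [X] plays the role of the set of cosets, [t] is a
   transversal, and [run]/[coc] spell out a homomorphism from the group of [e]
   to the wreath product of the group of [e'] with the symmetric group of [X]. *)
Section Cocycle.
Variables (V V' : Type) (e : V -> V -> Prop) (e' : V' -> V' -> Prop).
Variables (X : finType) (f g : V -> X -> X) (tau : X -> V -> word V').
Hypotheses (fK : forall a, cancel (f a) (g a)) (gK : forall a, cancel (g a) (f a)).

Definition act (x : X) (a : letter V) : X := if a.2 then f a.1 x else g a.1 x.
Definition run (x : X) (w : word V) : X := foldl act x w.

(** The value on an inverse letter is forced: going along [a] and back must give the trivial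
    element. *)
Definition coc_letter (x : X) (a : letter V) : word V' :=
  if a.2 then tau x a.1 else inv_word (tau (g a.1 x) a.1).
Fixpoint coc (x : X) (w : word V) : word V' :=
  if w is a :: w' then coc_letter x a ++ coc (act x a) w' else [::].

Lemma run_cat x u v : run x (u ++ v) = run (run x u) v.
Proof. exact: foldl_cat. Qed.

Lemma coc_cat x u v : coc x (u ++ v) = coc x u ++ coc (run x u) v.
Proof. by elim: u x => //= a u IH x; rewrite IH catA. Qed.

Lemma coc1 x a : coc x [:: (a, true)] = tau x a.
Proof. by rewrite /= cats0. Qed.

Lemma act_inv x a : act (act x a) (inv_letter a) = x.
Proof. by case: a => a [] /=; rewrite /act /= ?fK ?gK. Qed.

Lemma run_inv x w : run (run x w) (inv_word w) = x.
Proof.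
elim: w x => [|a w IH] x //.
by rewrite inv_word_cons run_cat -cat1s run_cat IH /= act_inv.
Qed.

Lemma coc_inv x w : coc (run x w) (inv_word w) = inv_word (coc x w).
Proof.
elim: w x => [|a w IH] x //.
rewrite inv_word_cons coc_cat -cat1s run_cat IH coc_cat inv_word_cat.
rewrite run_inv; congr (_ ++ _); rewrite /= !cats0.
by case: a => a []; rewrite /coc_letter /act /= ?fK ?inv_wordK.
Qed.

Lemma run_inv_fix x w : run x w = x -> run x (inv_word w) = x.
Proof. by move=> E; rewrite -{1}E run_inv. Qed.

Hypothesis fC : forall a b x, e a b -> f a (f b x) = f b (f a x).
Hypothesis tauC : forall a b x, e a b ->
  raag_eq e' (tau x a ++ tau (f a x) b) (tau x b ++ tau (f b x) a).

Lemma coc_raag_eq u v : raag_eq e u v ->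
  forall x, run x u = run x v /\ raag_eq e' (coc x u) (coc x v).
Proof.
move: u v; apply: raag_eq_least => [|a b eab x]; last first.
  by rewrite !coc_cat !coc1; split; [exact: esym (fC _ eab)|exact: tauC].
split=> [|u u' Eu v v' Ev x|a x].
- split=> [u x|u v E x|u v w E F x]; first by split=> //; reflexivity.
    by have [-> ->] := E x; split=> //; reflexivity.
  by have [-> ->] := E x; have [-> ->] := F x; split=> //; reflexivity.
- have [ru cu] := Eu x; have [rv cv] := Ev (run x u).
  by rewrite !run_cat !coc_cat -ru cu cv; split=> //; reflexivity.
- rewrite -[[:: a; _]]/([:: a] ++ inv_word [:: a]) run_cat run_inv coc_cat coc_inv.
  by split=> //; apply: congr_mulV.
Qed.

Variables (phi : V' -> word V) (t : X -> word V) (x0 : X).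
Hypothesis phiC : forall a b, e' a b -> comm (raag_eq e) (phi a) (phi b).
Hypothesis phi_run : forall a, run x0 (phi a) = x0.
Hypothesis phi_coc : forall a, raag_eq e' (coc x0 (phi a)) [:: (a, true)].
Hypothesis t0 : t x0 = [::].
Hypothesis t_tau : forall x a,
  raag_eq e (t x ++ [:: (a, true)]) (subst phi (tau x a) ++ t (f a x)).

(** On loops at [x0] the cocycle is a left inverse of [subst phi]; this yields injectivity. *)
Lemma coc_subst u :
  run x0 (subst phi u) = x0 /\ raag_eq e' (coc x0 (subst phi u)) u.
Proof.
elim: u => [|[a s] u [IHr IHc]]; first by split=> //; reflexivity.
rewrite -[(a, s) :: u]cat1s subst_cat run_cat coc_cat /subst /= cats0.
have [-> Ec] : run x0 (subst_letter phi (a, s)) = x0 /\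
    raag_eq e' (coc x0 (subst_letter phi (a, s))) [:: (a, s)].
  case: s; first by split; [exact: phi_run|exact: phi_coc].
  rewrite /subst_letter /=; split; first exact/run_inv_fix/phi_run.
  rewrite -{1}(phi_run a) coc_inv phi_coc; reflexivity.
split=> //; rewrite Ec -[flatten _]/(subst phi u) IHc; reflexivity.
Qed.

(** Schreier rewriting, letter by letter: every element is in the image of [subst phi] up to a
    transversal element. For an inverse letter, [t_tau] is used at the preceding coset [g a x]. *)
Lemma transversal_run x w :
  raag_eq e (t x ++ w) (subst phi (coc x w) ++ t (run x w)).
Proof.
elim: w x => [|[a s] w IH] x; first by rewrite cats0; reflexivity.
rewrite /= subst_cat -catA -IH -cat1s catA [in X in _ _ X]catA.
have -> : raag_eq e (t x ++ [:: (a, s)])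
   (subst phi (coc_letter x (a, s)) ++ t (act x (a, s))); last by reflexivity.
case: s; first exact: t_tau.
rewrite /coc_letter /act /= subst_inv.
have := t_tau (g a x) a; rewrite gK => E.
apply: (@congr_cancelr _ _ _ _ _ [:: (a, true)]); rewrite -!catA E.
rewrite congr_mulVK -[X in t x ++ X]/(inv_word [:: (a, true)] ++ [:: (a, true)]).
by rewrite congr_Vmul cats0; reflexivity.
Qed.

Lemma cocycle_fi_embeds : fi_embeds e' e.
Proof.
exists phi; split.
  move=> u v; split; first exact: subst_raag_eq.
  move=> /coc_raag_eq/(_ x0) [_].
  by have [_ ->] := coc_subst u; have [_ ->] := coc_subst v.
(* The transversal describes right cosets whereas [fi_embeds] asks for left ones, so [w] is inverted
   first. *)
exists X, (fun x => inv_word (t x)) => w.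
have := transversal_run x0 (inv_word w); rewrite t0 /= => E.
exists (run x0 (inv_word w)), (inv_word (coc x0 (inv_word w))).
by rewrite subst_inv -inv_word_cat -E inv_wordK; reflexivity.
Qed.

End Cocycle.

(** * Graph isomorphisms, and trees over arbitrary index types *)

Definition graph_iso (V' V : Type) (e' : V' -> V' -> Prop) (e : V -> V -> Prop) :=
  exists F : V' -> V, [/\ injective F, forall y, exists x, F x = y &
    forall x y, e' x y <-> e (F x) (F y)].

Lemma graph_iso_sym (V' V : Type) (e' : V' -> V' -> Prop) (e : V -> V -> Prop) :
  graph_iso e' e -> graph_iso e e'.
Proof.
move=> [F [Finj Fsurj FE]].
pose G y := proj1_sig (constructive_indefinite_description _ (Fsurj y)).
have GK y : F (G y) = y by rewrite /G; case: constructive_indefinite_description.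
exists G; split=> [x y E|x|x y]; first by rewrite -(GK x) E GK.
  by exists (F x); apply: Finj; rewrite GK.
by rewrite FE !GK.
Qed.

(** The cocycle argument with a single coset. *)
Lemma graph_iso_fi_embeds (V' V : Type) (e' : V' -> V' -> Prop) (e : V -> V -> Prop) :
  graph_iso e' e -> fi_embeds e' e.
Proof.
move=> [F [Finj Fsurj FE]].
pose G y := proj1_sig (constructive_indefinite_description _ (Fsurj y)).
have GK y : F (G y) = y by rewrite /G; case: constructive_indefinite_description.
have FK x : G (F x) = x by apply: Finj; rewrite GK.
apply: (@cocycle_fi_embeds V V' e e' unit (fun _ x => x) (fun _ x => x)
  (fun _ a => [:: (G a, true)]) _ _ _ _ (fun b => [:: (F b, true)])
  (fun _ => [::]) tt) => //.
- move=> a b _ eab; apply: raag_eq_step; apply: (raag_comm [::] [::]) => /=.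
  by rewrite FE !GK.
- by move=> a b eab; apply: raag_eq_step; apply: (raag_comm [::] [::]); apply/FE.
- by move=> a; rewrite coc1 FK; reflexivity.
- by move=> x a; rewrite cats0 subst1 GK; reflexivity.
Qed.

(** Arbitrary index types let the vertices of a cover be indexed by sums and products; all counting
    is deferred to [gadj_iso_tadj]. *)
Inductive gvert (A P : Type) (L : P -> Type) : Type :=
| GCenter
| GHair of A
| GPivot of P
| GLeaf (v : P) of L v.

Arguments GCenter {A P L}.
Arguments GHair {A P L}.
Arguments GPivot {A P L}.
Arguments GLeaf {A P L}.

Definition gadj (A P : Type) (L : P -> Type) (x y : gvert A L) : Prop :=
  match x, y with
  | GCenter, GHair _ | GHair _, GCenter => True
  | GCenter, GPivot _ | GPivot _, GCenter => True
  | GPivot v, GLeaf w _ | GLeaf w _, GPivot v => v = w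
  | _, _ => False
  end.

Lemma gadj_sym A P L (x y : @gvert A P L) : gadj x y -> gadj y x.
Proof. by case: x; case: y. Qed.

Lemma comm_gadj A P L (x y : @gvert A P L) :
  gadj x y -> comm (raag_eq (@gadj A P L)) [:: (x, true)] [:: (y, true)].
Proof. by move=> xy; apply: raag_eq_step; apply: (raag_comm [::] [::]). Qed.

Lemma comm_conj (V : Type) (R : word V -> word V -> Prop) {RC : word_congr R} t u v :
  comm R u v -> comm R (t ++ u ++ inv_word t) (t ++ v ++ inv_word t).
Proof.
rewrite /comm => E; rewrite -!catA !congr_mulVK (catA u) E -catA; reflexivity.
Qed.

Lemma val_ordS n (x : 'I_n.+1) :
  ordS x = (if x == ord_max then 0 else x.+1) :> nat.
Proof.
rewrite /=; case: eqP => [->|/eqP ne]; first by rewrite modnn.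
by rewrite modn_small // ltnS ltn_neqAle ne -ltnS /=.
Qed.

(** * Covers given by a homomorphism to a cyclic group of order [n.+1] *)

Section CyclicCover.
Variables (V V' : Type) (n : nat) (rot : V -> bool) (tau : 'I_n.+1 -> V -> word V').

Definition rotf (a : V) (x : 'I_n.+1) := if rot a then ordS x else x.
Definition rotg (a : V) (x : 'I_n.+1) := if rot a then ord_pred x else x.

Lemma rotfK a : cancel (rotf a) (rotg a).
Proof. by move=> x; rewrite /rotf /rotg; case: rot => //; rewrite ordSK. Qed.

Lemma rotgK a : cancel (rotg a) (rotf a).
Proof. by move=> x; rewrite /rotf /rotg; case: rot => //; rewrite ord_predK. Qed.

Lemma rotfC a b x : rotf a (rotf b x) = rotf b (rotf a x).
Proof. by rewrite /rotf; case: rot; case: rot. Qed.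

Lemma nseqSr (T : Type) j (a : T) : nseq j.+1 a = nseq j a ++ [:: a].
Proof. by elim: j => //= j <-. Qed.

Lemma run_nseq a j : rot a ->
  run rotf rotg ord0 (nseq j (a, true)) = j %% n.+1 :> nat.
Proof.
move=> ra; elim: j => [|j IH]; first by rewrite mod0n.
by rewrite nseqSr run_cat /= /act /= /rotf ra /= IH -addn1 modnDml addn1.
Qed.

Lemma run_nseq_ord a (x : 'I_n.+1) : rot a ->
  run rotf rotg ord0 (nseq x (a, true)) = x.
Proof. by move=> ra; apply: ord_inj; rewrite run_nseq // modn_small. Qed.

Lemma run_nseq_full a : rot a ->
  run rotf rotg ord0 (nseq n.+1 (a, true)) = ord0.
Proof. by move=> ra; apply: ord_inj; rewrite run_nseq // modnn. Qed.

Lemma run_conj a (x : 'I_n.+1) w : rot a -> run rotf rotg x w = x ->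
  run rotf rotg ord0 (nseq x (a, true) ++ w ++ inv_word (nseq x (a, true))) = ord0.
Proof.
move=> ra rw; rewrite !run_cat run_nseq_ord // rw -{1}(run_nseq_ord x ra).
by rewrite run_inv //; [exact: rotfK|exact: rotgK].
Qed.

Lemma coc_conj (R : word V' -> word V' -> Prop) (RC : word_congr R)
    a (x : 'I_n.+1) w : rot a -> run rotf rotg x w = x ->
  R (coc rotf rotg tau ord0 (nseq x (a, true))) [::] ->
  R (coc rotf rotg tau ord0 (nseq x (a, true) ++ w ++ inv_word (nseq x (a, true))))
    (coc rotf rotg tau x w).
Proof.
move=> ra rw E; rewrite !coc_cat run_nseq_ord // rw.
rewrite -[X in coc _ _ _ X (inv_word _)](run_nseq_ord x ra).
by rewrite coc_inv ?E /= ?cats0; [reflexivity|exact: rotfK|exact: rotgK].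
Qed.

(* Records the generator standing for [v ^ (n + 1)] when [v] leads from the last
   coset back to the first. *)
Definition wrap_word (x : 'I_n.+1) (a : V') : word V' :=
  if x == ord_max then [:: (a, true)] else [::].

Lemma subst_wrap_word (phi : V' -> word V) (x : 'I_n.+1) a b :
  phi a = nseq n.+1 b -> subst phi (wrap_word x a) ++ nseq (ordS x) b = nseq x.+1 b.
Proof.
rewrite val_ordS /wrap_word => E; case: eqP => [->|//].
by rewrite subst1 cats0 E.
Qed.

(** The factors [E] telescope along powers of [a], and the wrap letter [b] appears only when the
    last coset is left. *)
Lemma coc_nseq (R : word V' -> word V' -> Prop) (RC : word_congr R)
    (E : 'I_n.+1 -> word V') a b : rot a -> E ord0 = [::] ->
  (forall x, tau x a = inv_word (E x) ++ wrap_word x b ++ E (ordS x)) ->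
  (forall x : 'I_n.+1, R (coc rotf rotg tau ord0 (nseq x (a, true))) (E x)) /\
  R (coc rotf rotg tau ord0 (nseq n.+1 (a, true))) [:: (b, true)].
Proof.
move=> ra E0 tauE.
have H (x : 'I_n.+1) : R (coc rotf rotg tau ord0 (nseq x (a, true))) (E x).
  case: x => j; elim: j => [|j IH] ltj.
    by rewrite (_ : Ordinal ltj = ord0) ?E0; [reflexivity|apply: val_inj].
  have ltj' : j < n.+1 by exact: ltnW.
  rewrite [nat_of_ord _]/= nseqSr coc_cat coc1 (IH ltj').
  rewrite (run_nseq_ord (Ordinal ltj')) // tauE congr_mulKV /wrap_word.
  have -> : (Ordinal ltj' == ord_max) = false.
    by apply/eqP => /(congr1 val) /= jn; move: ltj; rewrite jn ltnn.
  rewrite (_ : ordS _ = Ordinal ltj); first by reflexivity.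
  by apply: val_inj; rewrite /= modn_small.
split=> //; rewrite nseqSr coc_cat coc1 (H ord_max) (run_nseq_ord ord_max) // tauE.
rewrite congr_mulKV /wrap_word eqxx (_ : ordS _ = ord0) ?E0; first by reflexivity.
by apply: val_inj; rewrite /= modnn.
Qed.

End CyclicCover.

(** * Unwrapping the center *)

Section LeafCover.
Variables (A P : Type) (L : P -> Type) (n : nat).

Let L' (v : P) : Type := ('I_n.+1 * L v)%type.
Let V := gvert A L.
Let V' := gvert A L'.
Let c : letter V := (GCenter, true).

Definition leaf_rot (a : V) : bool := if a is GCenter then true else false.

Definition leaf_tau (x : 'I_n.+1) (a : V) : word V' :=
  match a with
  | GCenter => wrap_word x GCenter
  | GHair h => [:: (GHair h, true)]
  | GPivot v => [:: (GPivot v, true)]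
  | GLeaf v b => [:: (GLeaf v (x, b), true)]
  end.

Definition leaf_phi (a : V') : word V :=
  match a with
  | GCenter => nseq n.+1 c
  | GHair h => [:: (GHair h, true)]
  | GPivot v => [:: (GPivot v, true)]
  | GLeaf v xb =>
      nseq xb.1 c ++ [:: (GLeaf v xb.2, true)] ++ inv_word (nseq xb.1 c)
  end.

(** Hair vertices and pivots commute with the center [c], so conjugating them by powers of [c] gives
    nothing new. A leaf [b] has the [n.+1] conjugates [c ^ x * b * c ^ - x], all commuting with its
    pivot since [c] does. The center itself becomes [c ^ (n + 1)]. *)
Lemma leaf_cover : fi_embeds (@gadj A P L') (@gadj A P L).
Proof.
have commc (a : V) b : gadj GCenter a ->
    comm (raag_eq (@gadj A P L)) (nseq b c) [:: (a, true)].
  by move=> ca; apply: comm_sym; apply: comm_nseq; apply: comm_gadj; apply: gadj_sym.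
have wrapC (a : V') x : gadj GCenter a ->
    comm (raag_eq (@gadj A P L')) (wrap_word x GCenter) [:: (a, true)].
  rewrite /wrap_word => ca; case: eqP => _; first exact: comm_gadj.
  by apply: comm_sym; apply: comm0.
have [cocx cocn] := @coc_nseq V V' n leaf_rot leaf_tau (raag_eq (@gadj A P L')) _
  (fun _ => [::]) GCenter GCenter isT erefl (fun x => esym (cats0 _)).
apply: (@cocycle_fi_embeds V V' _ _ 'I_n.+1 (rotf leaf_rot) (rotg leaf_rot) leaf_tau
  (@rotfK _ _ _) (@rotgK _ _ _) _ _ leaf_phi (fun x => nseq x c) ord0) => //.
(* The remaining goals, in order: the permutations commute, the cocycle and then [leaf_phi] respect
   the relations, the images are loops at coset 0, the cocycle inverts [leaf_phi], and Schreier
   rewriting holds on generators. *)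
- by move=> *; apply: rotfC.
- move=> [|h|v|v a] [|h'|w|w b] x // eab.
  + exact: wrapC.
  + exact: wrapC.
  + by apply: comm_sym; apply: wrapC.
  + by apply: comm_sym; apply: wrapC.
  + exact: (@comm_gadj _ _ L' (GPivot v) (GLeaf w (x, b)) eab).
  + exact: (@comm_gadj _ _ L' (GLeaf v (x, a)) (GPivot w) eab).
- move=> [|h|v|v a] [|h'|w|w b] // eab.
  + exact: (commc _ n.+1).
  + exact: (commc _ n.+1).
  + by apply: comm_sym; exact: (commc _ n.+1).
  + by apply: comm_sym; exact: (commc _ n.+1).
  + rewrite /gadj in eab; subst w; apply: comm_cat; first by apply: comm_sym; apply: commc.
    apply: comm_cat; first exact: comm_gadj.
    by apply: comm_invr; apply: comm_sym; apply: commc.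
  + rewrite /gadj in eab; subst w; apply: comm_sym.
    apply: comm_cat; first by apply: comm_sym; apply: commc.
    apply: comm_cat; first exact: comm_gadj.
    by apply: comm_invr; apply: comm_sym; apply: commc.
- move=> [|h|v|v [x b]] //; first exact: run_nseq_full.
  exact: run_conj.
- move=> [|h|v|v [x b]] //; try by rewrite /= ?cats0; reflexivity.
  by rewrite /leaf_phi coc_conj ?coc1 //; reflexivity.
- move=> x [|h|v|v b].
  + by rewrite -nseqSr -(@subst_wrap_word V V' n leaf_phi x GCenter c) //; reflexivity.
  + by rewrite subst1 /= commc //; reflexivity.
  + by rewrite subst1 /= commc //; reflexivity.
  + rewrite subst1 -[leaf_phi _]/(nseq x c ++ [:: (GLeaf v b, true)] ++ inv_word (nseq x c)).
    by rewrite -[rotf _ _ _]/x -!catA congr_Vmul cats0; reflexivity.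
Qed.

End LeafCover.

(** * Unwrapping pivots: [option R] indexes those sent to a generator, [W] those sent to 0 *)

Section PivotCover.
Variables (A R W : Type) (L : option R + W -> Type) (n : nat).

Definition pivot_proj (v : option R + W * 'I_n.+1) : option R + W :=
  match v with inl r => inl r | inr wx => inr wx.1 end.

(** Writing [v0] for the pivot [None], each hair vertex [h] has the lifts [v0 ^ x * h * v0 ^ - x]. A
    pair [(r, y)] is a new hair vertex standing for [r ^ (y + 1) * v0 ^ - (y + 1)], which also
    commutes with the center. *)
Let A' : Type := (A * 'I_n.+1 + R * 'I_n)%type.
Let L' v := L (pivot_proj v).
Let V := gvert A L.
Let V' := gvert A' L'.
Let piv (v : option R) : letter V := (GPivot (inl v), true).
Let base (j : nat) : word V := nseq j (piv None).
Let conj (x : 'I_n.+1) (a : V) : word V := base x ++ [:: (a, true)] ++ inv_word (base x).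

Definition pivot_rot (a : V) : bool := if a is GPivot (inl _) then true else false.

(* Stands for [v ^ x * v0 ^ - x], where [v0 = None]; it is trivial when [v] is
   [v0] or [x] is [0]. *)
Definition pivot_diff (v : option R) (x : 'I_n.+1) : word V' :=
  match v, unlift ord0 x with
  | Some r, Some y => [:: (GHair (inr (r, y)), true)]
  | _, _ => [::]
  end.

(** Rewrites [v0 ^ x * a * v0 ^ - x'], where [x'] is the coset reached from [x] by [a]. A leaf of a
    rotating pivot [v] commutes with [v], so its conjugate by [v0 ^ x] is also its conjugate by
    [v0 ^ x * v ^ - x], the inverse of [pivot_diff v x]. Hence one lift of such a leaf is enough. *)
Definition pivot_tau (x : 'I_n.+1) (a : V) : word V' :=
  match a with
  | GCenter => [:: (GCenter, true)]
  | GHair h => [:: (GHair (inl (h, x)), true)]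
  | GPivot (inl v) =>
      inv_word (pivot_diff v x) ++ wrap_word x (GPivot (inl v)) ++ pivot_diff v (ordS x)
  | GPivot (inr w) => [:: (GPivot (inr (w, x)), true)]
  | GLeaf v b =>
      match v return L v -> word V' with
      | inl v => fun b => inv_word (pivot_diff v x) ++
          [:: (@GLeaf A' _ L' (inl v) b, true)] ++ pivot_diff v x
      | inr w => fun b => [:: (@GLeaf A' _ L' (inr (w, x)) b, true)]
      end b
  end.

Definition pivot_phi (a : V') : word V :=
  match a with
  | GCenter => [:: (GCenter, true)]
  | GHair (inl (h, x)) => conj x (GHair h)
  | GHair (inr (r, y)) =>
      nseq (lift ord0 y) (piv (Some r)) ++ inv_word (base (lift ord0 y))
  | GPivot (inl v) => nseq n.+1 (piv v)
  | GPivot (inr (w, x)) => conj x (GPivot (inr w))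
  | GLeaf v b =>
      match v return L' v -> word V with
      | inl v => fun b => [:: (@GLeaf A _ L (inl v) b, true)]
      | inr (w, x) => fun b => conj x (@GLeaf A _ L (inr w) b)
      end b
  end.

Local Notation eqV := (raag_eq (@gadj A _ L)).
Local Notation eqV' := (raag_eq (@gadj A' _ L')).

Lemma pivot_phi_diff v x :
  eqV (subst pivot_phi (pivot_diff v x)) (nseq x (piv v) ++ inv_word (base x)).
Proof.
case: v => [r|] /=; last by rewrite congr_mulV; reflexivity.
case: unliftP => [y ->|->]; last by reflexivity.
by rewrite subst1; reflexivity.
Qed.

Lemma pivot_diff0 v : pivot_diff v ord0 = [::].
Proof. by rewrite /pivot_diff unlift_none; case: v. Qed.

Lemma comm_center_diff v x : comm eqV' [:: (GCenter, true)] (pivot_diff v x).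
Proof.
rewrite /pivot_diff; case: v => [r|]; last exact: comm0.
by case: unlift => [y|]; [exact: comm_gadj|exact: comm0].
Qed.

Lemma comm_center_pivot_phi a : gadj GCenter a ->
  comm eqV [:: (GCenter, true)] (pivot_phi a).
Proof.
have commb x : comm eqV [:: (GCenter, true)] (base x).
  by apply: comm_nseq; apply: comm_gadj.
have commJ x (b : V) : gadj GCenter b -> comm eqV [:: (GCenter, true)] (conj x b).
  by move=> cb; do 2![apply: comm_cat => //]; [exact: comm_gadj|exact: comm_invr].
case: a => [|[[h x]|[r y]]|[v|[w x]]|v b] // _; try exact: commJ.
  apply: comm_cat; last exact: comm_invr.
  by apply: comm_nseq; apply: comm_gadj.
by apply: comm_nseq; apply: comm_gadj.
Qed.

Lemma comm_center_tau a x : gadj GCenter a ->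
  comm eqV' [:: (GCenter, true)] (pivot_tau x a).
Proof.
case: a => [|h|[v|w]|v b] // _; try exact: comm_gadj.
apply: comm_cat; first by apply: comm_invr; apply: comm_center_diff.
apply: comm_cat; last exact: comm_center_diff.
by rewrite /wrap_word; case: eqP => _; [exact: comm_gadj|exact: comm0].
Qed.

(** For a rotating pivot the inner [pivot_diff] factors cancel on both sides, and it remains to move
    the wrap letter, if any, past the leaf. *)
Lemma pivot_tauC v b x :
  eqV' (pivot_tau x (GPivot v) ++ pivot_tau (rotf pivot_rot (GPivot v) x) (GLeaf v b))
       (pivot_tau x (GLeaf v b) ++ pivot_tau x (GPivot v)).
Proof.
case: v b => [v|w] b; last first.
  exact: (@comm_gadj _ _ L' (GPivot (inr (w, x))) (@GLeaf A' _ L' (inr (w, x)) b)).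
rewrite /rotf /= -!catA !congr_mulKV.
have com : comm eqV' (wrap_word x (GPivot (inl v))) [:: (@GLeaf A' _ L' (inl v) b, true)].
  by rewrite /wrap_word; case: eqP => _; [exact: comm_gadj|apply: comm_sym; exact: comm0].
set l := (_, true) in com *.
rewrite -(cat1s l (pivot_diff v x)) -(cat1s l (pivot_diff v (ordS x))).
by rewrite (catA (wrap_word _ _)) com -!catA congr_mulKV; reflexivity.
Qed.

(** The transversal consists of the powers of [v0]. A pivot in [W] is conjugated together with its
    leaves, giving [n.+1] copies; a rotating pivot [v] survives as [v ^ (n + 1)] with its own
    leaves. *)
Lemma pivot_cover : fi_embeds (@gadj A' _ L') (@gadj A _ L).
Proof.
have coct v := @coc_nseq V V' n pivot_rot pivot_tau eqV' (raag_eq_congr _) (pivot_diff v)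
  (GPivot (inl v)) (GPivot (inl v)) isT (pivot_diff0 v) (fun x => erefl).
have cocb (x : 'I_n.+1) :
    eqV' (coc (rotf pivot_rot) (rotg pivot_rot) pivot_tau ord0 (base x)) [::].
  by have [-> _] := coct None; reflexivity.
have conjC x (a b : V) : gadj a b -> comm eqV (conj x a) (conj x b).
  by move=> ab; apply: comm_conj; apply: comm_gadj.
apply: (@cocycle_fi_embeds V V' _ _ 'I_n.+1 (rotf pivot_rot) (rotg pivot_rot) pivot_tau
  (@rotfK _ _ _) (@rotgK _ _ _) _ _ pivot_phi (fun x => base x) ord0) => //.
- by move=> *; apply: rotfC.
- move=> a b x; case: a b => [|h|v|v a] [|h'|w|w b] // eab.
  + exact: comm_center_tau.
  + exact: comm_center_tau.
  + by apply: comm_sym; apply: comm_center_tau.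
  + by apply: comm_sym; apply: comm_center_tau.
  + by rewrite /gadj in eab; subst w; apply: pivot_tauC.
  + by rewrite /gadj in eab; subst w; symmetry; apply: pivot_tauC.
- have pl v b : comm eqV (pivot_phi (GPivot v)) (pivot_phi (GLeaf v b)).
    case: v b => [v|[w x]] b; last exact: conjC.
    by apply: comm_sym; apply: comm_nseq; apply: comm_gadj.
  case=> [|h|v|v a] [|h'|w|w b] // eab;
    try exact: comm_center_pivot_phi; try by apply: comm_sym; apply: comm_center_pivot_phi.
  + by rewrite /gadj in eab; subst w; apply: pl.
  + by rewrite /gadj in eab; subst w; apply: comm_sym; apply: pl.
- case=> [|[[h x]|[r y]]|[v|[w x]]|[v|[w x]] b] //; try exact: run_conj.
    rewrite /pivot_phi run_cat run_nseq_ord //.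
    rewrite -{1}(@run_nseq_ord V n pivot_rot (GPivot (inl None)) (lift ord0 y)) //.
    by rewrite run_inv //; [exact: rotfK|exact: rotgK].
  exact: run_nseq_full.
- have cocJ x a : pivot_rot a = false -> eqV' (coc (rotf pivot_rot) (rotg pivot_rot)
      pivot_tau ord0 (conj x a)) (pivot_tau x a).
    move=> ra; rewrite -(coc1 (rotf pivot_rot) (rotg pivot_rot) pivot_tau); apply: (@coc_conj V V' n pivot_rot) => //.
      by rewrite /= /act /= /rotf ra.
    exact: cocb.
  case=> [|[[h x]|[r y]]|[v|[w x]]|[v|[w x]] b]; try exact: cocJ.
  + by rewrite coc1; reflexivity.
  + rewrite /pivot_phi coc_cat run_nseq_ord //.
    rewrite -[X in coc _ _ _ X (inv_word _)]
      (@run_nseq_ord V n pivot_rot (GPivot (inl None)) (lift ord0 y)) //.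
    rewrite coc_inv; [|exact: rotfK|exact: rotgK].
    have [-> _] := coct (Some r); have [-> _] := coct None.
    by rewrite /pivot_diff liftK; reflexivity.
  + by have [_ ->] := coct v; reflexivity.
  + by rewrite coc1 /= pivot_diff0; reflexivity.
- move=> x [|h|[v|w]|[v|w] b].
  + rewrite subst1 /pivot_phi.
    have -> // : eqV ([:: (GCenter, true)] ++ base (rotf pivot_rot GCenter x))
      (base x ++ [:: (GCenter, true)]); last by reflexivity.
    by apply: comm_nseq; apply: comm_gadj.
  + rewrite subst1 -[pivot_phi _]/(conj x _) -[rotf _ _ _]/x -!catA congr_Vmul cats0.
    by reflexivity.
  + rewrite !subst_cat subst_inv !pivot_phi_diff inv_word_cat inv_wordK.
    rewrite -[rotf _ _ _]/(ordS x) -!catA congr_Vmul cats0.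
    rewrite (@subst_wrap_word V V' n pivot_phi x _ (piv v)) // nseqSr congr_mulVK.
    by reflexivity.
  + rewrite subst1 -[pivot_phi _]/(conj x _) -[rotf _ _ _]/x -!catA congr_Vmul cats0.
    by reflexivity.
  + rewrite !subst_cat subst_inv !pivot_phi_diff inv_word_cat inv_wordK subst1.
    rewrite -[rotf _ _ _]/x -[pivot_phi _]/[:: (@GLeaf A _ L (inl v) b, true)].
    rewrite -!catA congr_Vmul cats0.
    have com : comm eqV [:: (@GLeaf A _ L (inl v) b, true)] (nseq x (piv v)).
      by apply: comm_nseq; apply: comm_gadj.
    by rewrite com congr_mulVK; reflexivity.
  + rewrite subst1 -[pivot_phi _]/(conj x _) -[rotf _ _ _]/x -!catA congr_Vmul cats0.
    by reflexivity.
Qed.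

End PivotCover.

(** * Finite sets over a base: matching and counting fibers *)

Section Fibers.
Variable T : eqType.

Lemma fiber_injection (P Q : finType) (d : P -> T) (d' : Q -> T) :
  (forall i, #|[pred v | d v == i]| = #|[pred v | d' v == i]|) ->
  exists2 f : P -> Q, injective f & forall v, d' (f v) = d v.
Proof.
move=> E.
pose s v := enum [pred w | d w == d v]; pose s' v := enum [pred w | d' w == d v].
have size_s v : size (s' v) = size (s v) by rewrite -!cardE E.
have vs v : v \in s v by rewrite mem_enum inE.
have [y0 _|Q0] := pickP (@predT Q); last first.
  suff P0 : P -> False by exists (fun v => False_rect Q (P0 v)) => v; case: (P0 v).
  move=> v; have := vs v; have := size_s v.
  by rewrite /s' (eq_enum (B := pred0)) ?enum0 => [|y]; [case: (s v)|have := Q0 y].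
(* Elements at the same position in corresponding fibers are matched; the default [y0] is never
   reached since the fibers have equal size. *)
pose f v := nth y0 (s' v) (index v (s v)).
have fE v : d' (f v) = d v.
  have : f v \in s' v by rewrite mem_nth // size_s index_mem.
  by rewrite mem_enum inE => /eqP.
exists f => // v w E'; have dE : d v = d w by rewrite -!fE E'.
have sE : s v = s w by rewrite /s dE.
have sE' : s' v = s' w by rewrite /s' dE.
move/eqP: E'; rewrite /f sE' sE nth_uniq ?enum_uniq ?size_s ?index_mem //; last first.
  by rewrite -sE.
by move/eqP => iE; rewrite -(nth_index v (vs w)) -iE nth_index // -sE.
Qed.

Lemma fiber_bijection (P Q : finType) (d : P -> T) (d' : Q -> T) :
  (forall i, #|[pred v | d v == i]| = #|[pred v | d' v == i]|) ->
  exists f : P -> Q, [/\ injective f, forall y, exists x, f x = y &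
    forall v, d' (f v) = d v].
Proof.
move=> E; have [f finj fE] := fiber_injection E.
have [g ginj _] := fiber_injection (fun i => esym (E i)).
exists f; split=> // y.
by have /codomP[x ->] := inj_card_onto finj (leq_card _ ginj) y; exists x.
Qed.

Lemma card_fiber_sum (P Q : finType) (d : P + Q -> T) i :
  #|[pred v | d v == i]| =
  #|[pred v | d (inl v) == i]| + #|[pred v | d (inr v) == i]|.
Proof. by rewrite -!sum1_card big_sumType. Qed.

Lemma card_fiber_option (P : finType) (d : option P -> T) i :
  #|[pred v | d v == i]| = (d None == i) + #|[pred v | d (Some v) == i]|.
Proof.
have someI : injective (@Some P) by move=> a b [].
rewrite (cardD1 None) inE; congr (_ + _).
rewrite -(card_image someI); apply: eq_card => -[v|]; rewrite !inE /=.
  by rewrite mem_image.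
by apply/esym/negbTE/negP => /imageP[].
Qed.

Lemma card_fiber_prod (P Q : finType) (d : P -> T) i :
  #|[pred v : P * Q | d v.1 == i]| = #|[pred v | d v == i]| * #|Q|.
Proof.
by rewrite -cardX; apply: eq_card => -[v w]; rewrite !inE andbT.
Qed.

End Fibers.

(** * Identification of abstract trees with the trees [T((m_i,k_i);p)] *)

Section TreeRepresentation.
Variables (l : nat).

Lemma card_fiber_tag (k : 'I_l -> nat) i :
  #|[pred v : {i : 'I_l & 'I_(k i)} | tag v == i]| = k i.
Proof.
rewrite -[RHS]card_ord (bij_eq_card (tag_with_bij (fun i => 'I_(k i)) i)) card_sig.
by apply: eq_card => v; rewrite !inE.
Qed.

Lemma card_tagged_ord (k : 'I_l -> nat) :
  #|{: {i : 'I_l & 'I_(k i)}}| = \sum_i k i.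
Proof.
rewrite card_tagged sumnE big_map big_enum.
by apply: eq_bigr => i _; rewrite card_ord.
Qed.

Lemma tagged_ord_eqP (k : 'I_l -> nat) (s t : {i : 'I_l & 'I_(k i)}) :
  tag s = tag t /\ nat_of_ord (tagged s) = nat_of_ord (tagged t) <-> s = t.
Proof.
split=> [|->] //; case: s t => [i a] [j b] /= [ij]; subst j.
by move=> ab; congr existT; apply: val_inj.
Qed.

Variables (m k : 'I_l -> nat) (p : nat).

Lemma TLeaf_eq (s t : {i : 'I_l & 'I_(k i)}) (a : 'I_(m (tag s))) (b : 'I_(m (tag t))) :
  s = t -> a = b :> nat ->
  TLeaf (tag s) (tagged s) a = TLeaf (tag t) (tagged t) b :> tvert m k p.
Proof. by move=> st; subst t => ab; congr TLeaf; apply: val_inj. Qed.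

(** These projections read off the indices from an equation between dependent constructors. *)
Let tpivot (x : tvert m k p) : option {i : 'I_l & 'I_(k i)} :=
  match x with TPivot i j | TLeaf i j _ => Some (Tagged _ j) | _ => None end.
Let tleaf (x : tvert m k p) : nat := if x is TLeaf _ _ a then nat_of_ord a else 0.

(** With [ty] giving the type of each pivot, counts determine the tree: equal fibers give a
    bijection of pivots preserving types, and the leaves and hair vertices are then simply
    enumerated. *)
Lemma gadj_iso_tadj (A P : finType) (L : P -> finType) (ty : P -> 'I_l) :
  #|A| = p -> (forall i, #|[pred v | ty v == i]| = k i) ->
  (forall v, #|L v| = m (ty v)) ->
  graph_iso (@gadj A P L) (@tadj l m k p).
Proof.
move=> cA cP cL.
have [f [finj fsurj fE]] : exists f : P -> {i : 'I_l & 'I_(k i)},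
    [/\ injective f, forall y, exists x, f x = y & forall v, tag (f v) = ty v].
  by apply: fiber_bijection => i; rewrite cP card_fiber_tag.
have cL' v : #|L v| = m (tag (f v)) by rewrite fE.
pose F (x : gvert A L) : tvert m k p := match x with
  | GCenter => TCenter
  | GHair h => THair (cast_ord cA (enum_rank h))
  | GPivot v => TPivot (tag (f v)) (tagged (f v))
  | GLeaf v b => TLeaf (tag (f v)) (tagged (f v)) (cast_ord (cL' v) (enum_rank b))
  end.
have Sinj (s t : {i : 'I_l & 'I_(k i)}) : Some (Tagged (fun i => 'I_(k i)) (tagged s)) =
    Some (Tagged (fun i => 'I_(k i)) (tagged t)) -> s = t.
  by case: s t => [i a] [j b] /(congr1 (odflt (Tagged _ a))).
exists F; split.
- move=> [|h|v|v a] [|h'|w|w b] //= E.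
  + by case: E => /val_inj/enum_rank_inj ->.
  + by rewrite (finj v w) //; apply/Sinj/(congr1 tpivot E).
  + have vw : v = w by apply/finj/Sinj/(congr1 tpivot E).
    subst w.
    by have /= /val_inj/enum_rank_inj -> := congr1 tleaf E.
- move=> [|h|i j|i j a].
  + by exists GCenter.
  + by exists (GHair (enum_val (cast_ord (esym cA) h))); rewrite /= enum_valK cast_ordKV.
  + by have [v vE] := fsurj (Tagged _ j); exists (GPivot v); rewrite /= vE.
  + have [v vE] := fsurj (Tagged _ j).
    have mi : m i = #|L v| by rewrite cL' vE.
    exists (GLeaf v (enum_val (cast_ord mi a))) => /=.
    by rewrite (@TLeaf_eq _ (Tagged _ j) _ a) //= enum_valK.
- move=> [|h|v|v a] [|h'|w|w b] //=; rewrite tagged_ord_eqP.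
  + by split=> [->|/finj].
  + by split=> [->|/finj].
Qed.

End TreeRepresentation.

(** * The covers in terms of tree parameters, and the common cover *)

Lemma sum_ord_eq l (i0 : 'I_l) : \sum_(i < l) (i == i0 : nat) = 1.
Proof. by rewrite (bigD1 i0) //= eqxx big1 // => i /negbTE ->. Qed.

Lemma leaf_scaling_embeds l (m k : 'I_l -> nat) p n : 0 < n ->
  fi_embeds (@tadj l (fun i => n * m i) k p) (@tadj l m k p).
Proof.
case: n => // n _.
pose P := {i : 'I_l & 'I_(k i)}.
have iso m' (L : P -> finType) : (forall v, #|L v| = m' (tag v)) ->
    graph_iso (@gadj 'I_p P L) (@tadj l m' k p).
  by apply: gadj_iso_tadj; [exact: card_ord|exact: card_fiber_tag].
apply: fi_embeds_trans (graph_iso_fi_embeds (graph_iso_sym (iso _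
  (fun v => ('I_n.+1 * 'I_(m (tag v)))%type) _))) _.
  by move=> v; rewrite card_prod !card_ord.
apply: fi_embeds_trans (leaf_cover _ _ _) _.
by apply/graph_iso_fi_embeds/iso => v; rewrite card_ord.
Qed.

(** The pivot cover of degree [n.+1]: [w i] pivots of type [i] are sent to 0, and [i0] is the type
    of the distinguished rotating pivot. The last hypothesis says that [chi] is multiplied by
    [n.+1], written without subtraction. *)
Lemma pivot_change_embeds l (m k k' w : 'I_l -> nat) p p' n i0 :
  (forall i, w i + (i == i0) <= k i) -> (forall i, k' i = k i + n * w i) ->
  p' + \sum_i k' i + n = n.+1 * (p + \sum_i k i) ->
  fi_embeds (@tadj l m k' p') (@tadj l m k p).
Proof.
move=> wk k'E p'E.
pose r i := k i - w i - (i == i0).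
have kE i : k i = (i0 == i) + r i + w i by have := wk i; rewrite /r eq_sym; lia.
pose R := {i : 'I_l & 'I_(r i)}; pose W := {i : 'I_l & 'I_(w i)}.
pose ty (v : option R + W) :=
  match v with inl None => i0 | inl (Some a) => tag a | inr b => tag b end.
pose L v : finType := 'I_(m (ty v)).
have K : \sum_i k i = 1 + \sum_i r i + \sum_i w i.
  under eq_bigr do rewrite kE.
  rewrite !big_split /=; congr (_ + _ + _).
  by under eq_bigr do rewrite eq_sym; apply: sum_ord_eq.
have K' : \sum_i k' i = \sum_i k i + n * \sum_i w i.
  by under eq_bigr do rewrite k'E; rewrite big_split big_distrr.
apply: fi_embeds_trans (graph_iso_fi_embeds (graph_iso_sym (@gadj_iso_tadj _ _ _ _
  ('I_p * 'I_n.+1 + R * 'I_n)%type (option R + W * 'I_n.+1)%type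
  (fun v => L (pivot_proj v)) (fun v => ty (pivot_proj v)) _ _ _))) _.
- rewrite card_sum !card_prod !card_ord card_tagged_ord.
  by move: p'E; rewrite K' K; nia.
- move=> i; rewrite card_fiber_sum card_fiber_option /= card_fiber_tag.
  rewrite (card_fiber_prod _ (fun b : W => tag b)) card_fiber_tag card_ord k'E kE.
  by rewrite mulnS; lia.
- by move=> v; rewrite card_ord.
apply: fi_embeds_trans (@pivot_cover 'I_p R W (fun v => L v) n) _.
apply: graph_iso_fi_embeds; apply: (@gadj_iso_tadj _ _ _ _ 'I_p (option R + W)%type L ty).
- exact: card_ord.
- by move=> i; rewrite card_fiber_sum card_fiber_option /= !card_fiber_tag kE.
- by move=> v; rewrite card_ord.
Qed.

(** Each double cover adds one pivot and doubles [chi], so [a] is a power of 2. Once [k = t], a last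
    cover with all pivots rotating contributes the free factor [n]. *)
Lemma pivot_raise_embeds l (m k t : 'I_l -> nat) p :
  (forall i, 0 < k i <= t i) -> 2 <= \sum_i k i ->
  exists2 a, 0 < a & forall n p', 0 < n ->
    p' + \sum_i t i = (a * n * (p + \sum_i k i).-1).+1 ->
    fi_embeds (@tadj l m t p') (@tadj l m k p).
Proof.
move=> kt K2; have [N] := ubnP (\sum_i (t i - k i)).
elim: N k p kt K2 => // N IH k p kt K2 leN.
have [i0 lt0|all_le] := pickP (fun i => k i < t i); last first.
  have tk i : t i = k i by have := kt i; have := all_le i; lia.
  have [i0 _|I0] := pickP (@predT 'I_l); last by move: K2; rewrite big_pred0.
  exists 1 => // -[//|n] p' _; rewrite mul1n => p'E.
  apply: (@pivot_change_embeds l m k t (fun _ => 0) p p' n i0) => [i|i|].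
  - by have := kt i; case: eqP; lia.
  - by rewrite tk muln0 addn0.
  - by move: p'E; move: K2; nia.
(* The double cover fixes a pivot of type [i0] and needs another, of type [i1], that rotates. If
   [i0] is the only type, then [k i0] is at least 2 and [i1 = i0] works. *)
have [i1 i1P] : exists i1, forall i, (i == i0) + (i == i1) <= k i.
  have [i1 ne|eq0] := pickP (fun i => i != i0).
    exists i1 => i; have := kt i; case: (eqVneq i i0) => [->|_]; last by case: eqP; lia.
    by rewrite eq_sym (negbTE ne); lia.
  exists i0 => i; have /negbFE/eqP -> := eq0 i; rewrite eqxx.
  by move: K2; rewrite (bigD1 i0) //= big_pred0 ?addn0 // => j; rewrite eq0.
pose k1 i := k i + 1 * (i == i0).
have K1 : \sum_i k1 i = (\sum_i k i).+1.
  by rewrite big_split -big_distrr /= sum_ord_eq; lia.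
(* Solves [p1 + K1 - 1 = 2 * (p + K - 1)] with [K1 = K + 1]; the subtraction is not truncated
   because [K] is at least 2. *)
pose p1 := (p + \sum_i k i).*2 - (\sum_i k i).+2.
have [||| a a0 aP] := IH k1 p1.
- move=> i; have := kt i; rewrite /k1; case: (eqVneq i i0) => [->|_]; last by lia.
  by move: lt0; lia.
- by rewrite K1; lia.
- suff : \sum_i (t i - k1 i) < \sum_i (t i - k i) by move: leN; lia.
  rewrite (bigD1 i0) //= [X in _ < X](bigD1 i0) //= /k1 eqxx.
  rewrite -addSn leq_add //; first by lia.
  by apply: leq_sum => i _; lia.
exists (2 * a) => [|n p' n0 p'E]; first by lia.
apply: fi_embeds_trans (aP n p' n0 _) _.
  by rewrite p'E K1 /p1; congr (_.+1); rewrite -!mulnA mulnCA; congr (_ * _);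
     rewrite mulnCA; congr (_ * _); lia.
apply: (@pivot_change_embeds l m k k1 (fun i => i == i0 : nat) p p1 1 i1) => //.
by rewrite K1 /p1; lia.
Qed.

Lemma tree_params_pivots l (d k : 'I_l -> nat) :
  tree_params d k -> 2 <= \sum_i k i.
Proof.
move=> [l0 dk _ [l2|[l1 k2]]].
  rewrite (leq_trans l2) // -{1}(card_ord l) -sum1_card leq_sum // => i _.
  by have [] := dk i.
by rewrite (bigD1 (Ordinal l0)) //= (leq_trans (k2 (Ordinal l0))) // leq_addr.
Qed.

Theorem mainTheorem5 (l : nat) (m k n r : 'I_l -> nat) (p q : nat) :
  tree_params m k -> tree_params n r ->
  (forall i j : 'I_l, m i * n j = m j * n i) ->
  raag_commensurable (@tadj l m k p) (@tadj l n r q).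
Proof.
move=> hT hS prop.
have K2 := tree_params_pivots hT; have R2 := tree_params_pivots hS.
have [l0 mk _ _] := hT; have [_ nr _ _] := hS.
(* By proportionality [n i0 * m i = m i0 * n i], so scaling the leaf numbers by [n i0] on one side
   and [m i0] on the other gives the same [d]. *)
pose i0 := Ordinal l0; pose d i := n i0 * m i; pose t i := maxn (k i) (r i).
have dE : d = (fun i => m i0 * n i).
  by apply: functional_extensionality => i; rewrite /d mulnC prop.
have [a a0 aP] : exists2 a, 0 < a & forall N p', 0 < N ->
    p' + \sum_i t i = (a * N * (p + \sum_i k i).-1).+1 ->
    fi_embeds (@tadj l d t p') (@tadj l d k p).
  apply: pivot_raise_embeds => // i.
  by have [_ ->] := mk i; rewrite leq_maxl.
have [b b0 bP] : exists2 b, 0 < b & forall N p', 0 < N ->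
    p' + \sum_i t i = (b * N * (q + \sum_i r i).-1).+1 ->
    fi_embeds (@tadj l d t p') (@tadj l d r q).
  apply: pivot_raise_embeds => // i.
  by have [_ ->] := nr i; rewrite leq_maxr.
set x := (p + _).-1 in aP; set y := (q + _).-1 in bP; set s := \sum_i t i in aP bP.
have x0 : 0 < x by rewrite /x; lia.
have y0 : 0 < y by rewrite /y; lia.
have s0 : 0 < s.
  by rewrite /s (bigD1 i0) //= ltn_addr // leq_max; have [_ ->] := mk i0.
(* The common cover has [chi = a * b * x * y * s], a multiple of both [a * x] and [b * y]; the
   factor [s] makes it at least [s], so that a hair number [p'] exists. *)
pose p' := (a * b * x * y * s).+1 - s.
have p'E : p' + s = (a * b * x * y * s).+1.
  by rewrite subnK // leqW // leq_pmull // !muln_gt0 a0 b0 x0 y0.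
apply: (@fi_embeds_commensurable _ _ _ (@tadj l d t p')).
  apply: fi_embeds_trans (aP (b * y * s) p' _ _) _.
  - by rewrite !muln_gt0 b0 y0.
  - by rewrite p'E; congr _.+1; lia.
  - by apply: leaf_scaling_embeds; have [] := nr i0.
apply: fi_embeds_trans (bP (a * x * s) p' _ _) _.
- by rewrite !muln_gt0 a0 x0.
- by rewrite p'E; congr _.+1; lia.
- by rewrite dE; apply: leaf_scaling_embeds; have [] := mk i0.
Qed.
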